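(* Let $G$ be an outerplanar graph. Then $s(G) \leq 3$, where $s(G)$ is the surrounding cop number of $G$.
   Context: A graph is outerplanar if it has a planar embedding in which every vertex lies on the exterior face. Surrounding Cops and Robbers is a perfect-information game played on a finite graph $G$ by two players. The first player controls a team of cops $C_1,\dots,C_m$; the second controls one robber. Initially, the first player places each cop on some vertex of $G$, and then the second player places the robber on some vertex of $G$. Then the two players alternate in taking turns. On the first player's turn, she moves each cop to an adjacent vertex or leaves it at its current vertex. On the second player's turn, he moves the robber to an adjacent vertex or leaves the robber at its current vertex. Two cops may occupy the same vertex, and a cop and the robber may occupy the same vertex, but the second player may not end a turn with the robber on the same vertex as a cop. The first player wins if at any point the robber occupies a vertex $r$ such that each neighbor of $r$ is occupied by a cop (the robber is surrounded). The second player wins by indefinitely preventing the first player from winning. The surrounding cop number $s(G)$ of a finite graph $G$ is the minimum $m$ such that the first player, with a team of $m$ cops, has a winning strategy on $G$.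
   Formalization: The graph G is additionally assumed to be connected; without this the claim fails, for example for four disjoint triangles, where three cops can never surround a robber placed in a triangle containing no cop. *)

(* Defs.v *)
From mathcomp Require Import all_boot all_order all_algebra.
From mathcomp Require Import all_classical all_reals all_analysis.

Set Implicit Arguments.
Unset Strict Implicit.
Unset Printing Implicit Defensive.

Import Order.TTheory GRing.Theory Num.Theory.
Import numFieldNormedType.Exports.
Local Open Scope classical_set_scope.
Local Open Scope ring_scope.

(* A finite simple graph is a symmetric irreflexive relation on a finType. *)

Section Outerplanarity.
Variables (R : realType) (T : finType) (e : rel T).

Definition is_arc (u v : R * R) (A : set (R * R)) : Prop :=
  exists f : R -> R * R,
    [/\ {within `[0, 1], continuous f},
        {in `[0, 1] &, injective f},
        f 0 = u, f 1 = v & A = f @` `[0, 1]].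

(* [gamma x y] is the point set of the edge xy, and is irrelevant when x and y
   are not adjacent. *)
Record planar_embedding (p : T -> R * R) (gamma : T -> T -> set (R * R)) :
    Prop := PlanarEmbedding {
  embedding_inj : injective p;
  embedding_arc : forall x y, e x y -> is_arc (p x) (p y) (gamma x y);
  embedding_sym : forall x y, e x y -> gamma x y = gamma y x;
  embedding_vertex : forall x y z,
    e x y -> gamma x y (p z) -> z = x \/ z = y;
  embedding_cross : forall x y u v,
    e x y -> e u v -> ~ (x = u /\ y = v) -> ~ (x = v /\ y = u) ->
    gamma x y `&` gamma u v `<=` range p
}.

Definition drawing (p : T -> R * R) (gamma : T -> T -> set (R * R)) :
    set (R * R) :=
  range p `|` [set q | exists x y, e x y /\ gamma x y q].

(* The complement of a compact subset of the plane has exactly one unbounded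
   component; it is described here without appealing to that fact. *)
Definition exterior_face (D : set (R * R)) : set (R * R) :=
  [set q | ~ D q /\ ~ bounded_set (connected_component (~` D) q)].

(* Vertices belong to the drawing, so lying on the boundary of the exterior
   face amounts to lying in its closure. *)
Definition outerplanar : Prop :=
  exists (p : T -> R * R) (gamma : T -> T -> set (R * R)),
    planar_embedding p gamma /\
    forall x, closure (exterior_face (drawing p gamma)) (p x).

End Outerplanarity.

Section SurroundingCopsAndRobbers.
Variables (T : finType) (e : rel T).

Definition move (x y : T) : bool := (x == y) || e x y.

Definition surrounded m (c : 'I_m -> T) (r : T) : Prop :=
  forall v, e r v -> exists i, c i = v.

(* A cop strategy maps the sequence of the robber's positions so far (oldest
   first) to the positions of the cops; at [::] it is their initial placement. *)
Definition cop_strategy (m : nat) := seq T -> 'I_m -> T.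

Definition legal_strategy m (s : cop_strategy m) : Prop :=
  forall h r i, move (s h i) (s (rcons h r) i).

(* [rho 0] is the initial placement of the robber and [rho k.+1] is his
   position after his (k+1)-st turn, which follows the cops' (k+1)-st turn,
   leading to [s (mkseq rho k.+1)]. *)
Definition legal_play m (s : cop_strategy m) (rho : nat -> T) : Prop :=
  forall k, move (rho k) (rho k.+1) /\
            forall i, s (mkseq rho k.+1) i <> rho k.+1.

Definition robber_surrounded m (s : cop_strategy m) (rho : nat -> T) : Prop :=
  exists k, surrounded (s (mkseq rho k)) (rho k) \/
            surrounded (s (mkseq rho k.+1)) (rho k).

(* Infinite plays suffice: a robber who is not surrounded always has a legal
   move, since he can go to an unoccupied neighbour. *)
Definition winning_strategy m (s : cop_strategy m) : Prop :=
  legal_strategy s /\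
  forall rho, legal_play s rho -> robber_surrounded s rho.

Definition cops_win (m : nat) : Prop :=
  exists s : cop_strategy m, winning_strategy s.

Lemma cops_win_card : exists m, `[< cops_win m >].
Proof.
exists #|T|; apply/asboolP; exists (fun _ i => enum_val i); split.
  by move=> h r i; rewrite /move eqxx.
move=> rho _; exists 0%N; left => v _.
by exists (enum_rank v); rewrite enum_rankK.
Qed.

Definition surrounding_cop_number : nat := ex_minn cops_win_card.

End SurroundingCopsAndRobbers.

(* Main.v *)
Require Import Defs.
From mathcomp Require Import all_boot all_order all_algebra.
From mathcomp Require Import all_classical all_reals all_analysis.
From mathcomp Require Import zify lra.

Set Implicit Arguments.
Unset Strict Implicit.
Unset Printing Implicit Defensive.

(* The cops confine the robber to a connected set C whose complement is
   connected too and whose boundary {a, b} is occupied by two of them.  If some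
   t in C separates the neighbours of a from those of b inside C, the third cop
   walks to t: the robber is then confined to a component of C - t, which has
   the same properties and a boundary {x, t} with x in {a, b, t}.  If no such t
   exists, Menger's theorem for two paths gives disjoint Q1, Q2 inside C linking
   a to neighbours z1, z2 of b, and a, b, z1, z2 carry a K4 whose edges ab and
   z1z2 run in the complement of C and in C.

   Such a K4 contradicts outerplanarity: joining its vertices to a far point
   through the exterior face draws K5 so that independent edges are disjoint.
   All curves are replaced by finite chains of points with small steps, which
   connectedness provides, so neither general position nor the Jordan curve
   theorem is needed.  For disjoint chains A from x to x' and B from y to y',
   consider the grid of vectors a - b: counting modulo 2 how often its boundary
   crosses the negative half of the first axis gives 0, because every cell
   contributes 0.  This relates the crossings of A with half-lines issuing from
   y, y' to those of B with half-lines issuing from x, x'.  Summing the 15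
   relations for K5, every crossing number occurs twice, and what remains reads
   0 = 1. *)

(** * Induced connectivity *)

Lemma connect_ind_left (T : finType) (r : rel T) (P : T -> Prop) (y : T) :
  P y -> (forall u v, r u v -> P v -> P u) -> forall x, connect r x y -> P x.
Proof.
move=> Py PS x /connectP[s]; elim: s x => [|z s IH] x /=; first by move=> _ <-.
by case/andP=> xz zs yE; apply: PS xz (IH _ zs yE).
Qed.

Section InducedConnectivity.
Variables (T : finType) (e : rel T).
Hypothesis e_sym : symmetric e.

Definition induced (S : {set T}) : rel T :=
  [rel x y | [&& x \in S, y \in S & e x y]].

(** Reflexive even outside [S], hence the separate membership test in [component]. *)
Definition conn (S : {set T}) (x y : T) : bool := connect (induced S) x y.

Definition component (S : {set T}) (x : T) : {set T} :=
  [set y in S | conn S x y].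

Definition boundary (C : {set T}) : {set T} :=
  [set x | (x \notin C) && [exists y in C, e x y]].

Definition connected_set (S : {set T}) : Prop :=
  {in S &, forall x y, conn S x y}.

Lemma conn_sym S : symmetric (conn S).
Proof.
apply: sym_connect_sym => x y; rewrite /induced /= e_sym.
by case: (x \in S); case: (y \in S).
Qed.

Lemma conn0 S x : conn S x x.
Proof. exact: connect0. Qed.

Lemma conn_trans S y x z : conn S x y -> conn S y z -> conn S x z.
Proof. exact: connect_trans. Qed.

Lemma conn1 (S : {set T}) x y : x \in S -> y \in S -> e x y -> conn S x y.
Proof. by move=> xS yS xy; apply: connect1; rewrite /induced /= xS yS. Qed.

Lemma conn_sub (S S' : {set T}) x y :
  S \subset S' -> conn S x y -> conn S' x y.
Proof.
move=> /fintype.subsetP sSS'; apply: connect_sub => u v /and3P[uS vS uv].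
by apply: conn1; rewrite ?sSS'.
Qed.

Lemma conn_ind (S : {set T}) (P : T -> Prop) y :
  P y ->
  (forall u v, u \in S -> v \in S -> e u v -> P v -> P u) ->
  forall x, conn S x y -> P x.
Proof.
by move=> Py PS; apply: connect_ind_left => // u v /and3P[]; apply: PS.
Qed.

Lemma connected_setP (S : {set T}) x :
  (forall y, y \in S -> conn S x y) -> connected_set S.
Proof.
move=> H y z yS zS; apply: conn_trans (H z zS); rewrite conn_sym; exact: H.
Qed.

Lemma component_sub S x : component S x \subset S.
Proof. by apply/fintype.subsetP=> y; rewrite inE => /andP[]. Qed.

Lemma mem_component (S : {set T}) x : x \in S -> x \in component S x.
Proof. by move=> xS; rewrite inE xS conn0. Qed.

Lemma component_stable S x u v :
  u \in component S x -> v \in S -> e u v -> v \in component S x.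
Proof.
rewrite !inE => /andP[uS xu] vS uv; rewrite vS.
by apply: conn_trans xu _; apply: conn1.
Qed.

Lemma component_root (S : {set T}) x y : x \in S ->
  y \in component S x -> conn (component S x) x y.
Proof.
move=> xS; rewrite inE => /andP[yS]; rewrite conn_sym => yx.
suff [_ ] : y \in component S x /\ conn (component S x) y x by rewrite conn_sym.
move: y yx {yS}; apply: conn_ind.
  by split; [apply: mem_component|apply: conn0].
move=> u v uS vS uv [vC vx].
have uC : u \in component S x by apply: component_stable vC _ _; rewrite // e_sym.
by split=> //; apply: conn_trans vx; apply: conn1.
Qed.

Lemma connected_set_component (S : {set T}) x :
  x \in S -> connected_set (component S x).
Proof. by move=> xS; apply: (@connected_setP _ x) => y; apply: component_root. Qed.

Lemma component_boundary S x u v :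
  u \in component S x -> v \notin component S x -> e u v -> v \notin S.
Proof.
by move=> uC vC uv; apply: contra vC => vS; apply: component_stable uC vS uv.
Qed.

(** A path in [U] from outside the component to [q] can enter the component only from [t]; its part
    up to [t] avoids the component. *)
Lemma conn_setD_component (U : {set T}) t q x :
  connected_set U -> t \in U -> q \in U :\ t ->
  x \in U :\: component (U :\ t) q -> conn (U :\: component (U :\ t) q) t x.
Proof.
move=> Uconn tU qUt; set K := component _ q; rewrite finset.in_setD => /andP[xK xU].
have qU : q \in U by move: qUt; rewrite inE => /andP[].
rewrite conn_sym; move: (Uconn x q xU qU) xK; move: x {xU}.
apply: conn_ind => [|u v uU vU uv IH uK]; first by rewrite mem_component.
have [->|ut] := eqVneq u t; first exact: conn0.
have vK : v \notin K.
  apply: contra uK => vK; apply: component_stable vK _ _; last by rewrite e_sym.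
  by rewrite !inE ut.
by apply: conn_trans (IH vK); apply: conn1; rewrite // inE ?uK ?vK.
Qed.

Lemma component_adj (U : {set T}) t q :
  connected_set U -> t \in U -> q \in U :\ t ->
  exists2 y, y \in component (U :\ t) q & e t y.
Proof.
move=> Uconn tU qUt; set K := component _ q.
have qK : q \in K by apply: mem_component.
have tK : t \notin K by rewrite !inE eqxx.
have qU : q \in U by move: qUt; rewrite inE => /andP[].
have := Uconn t q tU qU; move: tK.
suff: forall x, conn U x q -> x \in K \/ exists2 y, y \in K & e t y.
  by move=> H tK /H[]//; rewrite (negPf tK).
apply: conn_ind; first by left.
move=> u v uU vU uv [vK|]; last by right.
 have [ut|ut] := eqVneq u t; first by right; exists v; rewrite // -ut.
left; apply: component_stable vK _ _; last by rewrite e_sym.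
by rewrite !inE ut.
Qed.

End InducedConnectivity.

(** * Menger's theorem for two paths *)

Section Linkage.
Variables (T : finType) (e : rel T).
Hypothesis e_sym : symmetric e.

Local Notation conn := (conn e).
Local Notation component := (component e).
Local Notation connected_set := (connected_set e).

Lemma connected_set1 x : connected_set [set x].
Proof. by move=> y z /set1P-> /set1P->; apply: conn0. Qed.

Lemma connected_setU (S K : {set T}) x y :
  connected_set S -> connected_set K -> x \in S -> y \in K -> e x y ->
  connected_set (S :|: K).
Proof.
move=> Sc Kc xS yK xy; apply: (connected_setP e_sym (x := x)) => z.
rewrite finset.in_setU => /orP[zS|zK].
  by apply: conn_sub (Sc _ _ xS zS); apply: finset.subsetUl.
apply: conn_trans (conn_sub (finset.subsetUr _ _) (Kc _ _ yK zK)).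
by apply: conn1; rewrite // finset.in_setU ?xS ?yK ?orbT.
Qed.

Variables (C B : {set T}) (a : T).
Hypothesis aC : a \notin C.
Hypothesis BC : B \subset C.

(** State of the search for two paths: disjoint sets [X] and [Y] grown from [a], and a connected
    reserve [U] meeting [B]. Both sets are adjacent to the same vertex [q] of [U], so either one
    could still reach [B] through the reserve. *)
Record partial_linkage (X Y U : {set T}) (q : T) : Prop := PartialLinkage {
  pl_XC : X \subset C;
  pl_YC : Y \subset C;
  pl_UC : U \subset C;
  pl_XY : {in X, forall x, x \notin Y};
  pl_XU : {in X, forall x, x \notin U};
  pl_YU : {in Y, forall x, x \notin U};
  pl_Xconn : connected_set (a |: X);
  pl_Yconn : connected_set (a |: Y);
  pl_Uconn : connected_set U;
  pl_X : exists2 x, x \in a |: X & e x q;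
  pl_Y : exists2 y, y \in a |: Y & e y q;
  pl_q : q \in U;
  pl_B : exists2 z, z \in B & z \in U
}.

Definition linkage : Prop :=
  exists (Q1 Q2 : {set T}) z1 z2,
    [/\ Q1 \subset C, Q2 \subset C & {in Q1, forall x, x \notin Q2}] /\
    [/\ z1 \in Q1, z1 \in B & connected_set (a |: Q1)] /\
    [/\ z2 \in Q2, z2 \in B & connected_set (a |: Q2)].

Lemma partial_linkage_sym X Y U q :
  partial_linkage X Y U q -> partial_linkage Y X U q.
Proof.
case=> ? ? ? XY *; split=> // x xY; by apply/negP => /XY; rewrite xY.
Qed.

Lemma partial_linkage_add X Y U q f y : partial_linkage X Y U q ->
  f \in C -> f \notin Y -> f \notin U -> y \in a |: X -> e y f ->
  partial_linkage (f |: X) Y U q.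
Proof.
case=> XC YC UC XY XU YU Xc Yc Uc aX aY qU BU fC fY fU yX yf; split=> //.
- by apply/fintype.subsetP=> x /setU1P[->//|]; apply/fintype.subsetP.
- by move=> x /setU1P[->//|]; apply: XY.
- by move=> x /setU1P[->//|]; apply: XU.
- rewrite finset.setUCA finset.setUC.
  by apply: connected_setU Xc (@connected_set1 f) yX _ yf; rewrite inE.
- by case: aX => x xX xq; exists x; rewrite // finset.setUCA finset.in_setU xX orbT.
Qed.

(** Once [X] meets [B], the whole reserve can be given to [Y], which enters it at [q]. *)
Lemma partial_linkage_done X Y U q z : partial_linkage X Y U q ->
  z \in X -> z \in B -> linkage.
Proof.
case=> XC YC UC XY XU YU Xc Yc Uc aX [y yY yq] qU [z' zB zU] zX zB'.
exists X, (Y :|: U), z, z'; split; split=> //.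
- by rewrite finset.subUset YC.
- by move=> x xX; rewrite finset.in_setU negb_or XY ?XU.
split=> //; first by rewrite finset.in_setU zU orbT.
by rewrite finset.setUA; apply: connected_setU Yc Uc yY qU yq.
Qed.

(** Here [X] has a second entrance [u] into [U]. Let [K] be the component of [q] in [U :\ u]. If [K]
    meets [B], it serves as the smaller reserve. Otherwise [Y] absorbs [K] and thereby becomes
    adjacent to [u], which takes the role of [q] in the reserve [U :\: K]. *)
Lemma partial_linkage_step X Y U q u v : partial_linkage X Y U q ->
  v \in a |: X -> u \in U -> u != q -> e v u ->
  exists Y' U' q', partial_linkage X Y' U' q' /\
    (#|U'| < #|U| /\ Y \subset Y')%N.
Proof.
case=> XC YC UC XY XU YU Xc Yc Uc aX [y yY yq] qU [z zB zU] vX uU uq vu.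
have qUu : q \in U :\ u by rewrite !inE eq_sym uq.
set K := component (U :\ u) q.
have KU : K \subset U.
  by apply: fintype.subset_trans (component_sub _ _ _) _; apply: finset.subD1set.
have uK : u \notin K by rewrite !inE eqxx.
have qK : q \in K by apply: mem_component.
have Kc : connected_set K by apply: connected_set_component.
have [[w wB wK]|noB] := pselect (exists2 w, w \in B & w \in K).
  exists Y, K, q; split; last first.
    split=> //; apply: proper_card; apply/properP; split=> //.
    by exists u.
  split=> //; first exact: fintype.subset_trans UC.
  - by move=> x /XU; apply: contra; apply/fintype.subsetP.
  - by move=> x /YU; apply: contra; apply/fintype.subsetP.
  - by exists y.
  - by exists w.
have [t tK ut] := component_adj e_sym Uc uU qUu.
exists (Y :|: K), (U :\: K), u; split; last first.
  split; last exact: finset.subsetUl.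
  apply: proper_card; apply/properP; split; first exact: finset.subsetDl.
  by exists q; rewrite // inE qK.
split=> //.
- by rewrite finset.subUset YC (fintype.subset_trans KU UC).
- by apply: fintype.subset_trans UC; apply: finset.subsetDl.
- move=> x xX; rewrite finset.in_setU negb_or XY //=.
  by apply: contra (XU _ xX); apply/fintype.subsetP.
- by move=> x xX; rewrite finset.in_setD negb_and (XU _ xX) orbT.
- move=> x; rewrite finset.in_setU finset.in_setD negb_and negbK => /orP[xY|->//].
  by rewrite (YU _ xY) orbT.
- by rewrite finset.setUA; apply: connected_setU Yc Kc yY qK yq.
- apply: (connected_setP e_sym (x := u)) => x xUK.
  exact: conn_setD_component.
- by exists v.
- exists t; last by rewrite e_sym.
  by rewrite !finset.in_setU tK !orbT.
- by rewrite finset.in_setD uK.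
exists z => //; rewrite finset.in_setD zU andbT.
by apply/negP=> zK; apply: noB; exists z.
Qed.

Hypothesis no_cut : forall q, q \in C ->
  exists z, [/\ z \in B, z != q & conn (a |: (C :\ q)) a z].

(** Adding a vertex outside the reserve lowers the second term of the measure;
    [partial_linkage_step] lowers the first and does not raise the second. When nothing can be
    added, a path from [a] to [B] avoiding [q] either ends inside [X] or [Y], or leaves them
    directly into [U] at a vertex other than [q]. *)
Lemma partial_linkage_extend n (X Y U : {set T}) q :
  (#|U| + #|C :\: (X :|: Y)| <= n)%N -> partial_linkage X Y U q -> linkage.
Proof.
elim: n X Y U q => [|n IH] X Y U q leq_n L.
  have qU := pl_q L; suff: (0 < #|U|)%N by move: leq_n; case: #|U|.
  by apply/card_gt0P; exists q.
have grow X' Y' f y : partial_linkage X' Y' U q -> X' :|: Y' = X :|: Y ->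
    f \in C -> f \notin X' -> f \notin Y' -> f \notin U -> y \in a |: X' -> e y f ->
    linkage.
  move=> L' XYE fC fX fY fU yX yf.
  apply: (IH _ _ _ _ _ (partial_linkage_add L' fC fY fU yX yf)).
  rewrite -ltnS; apply: leq_trans leq_n; rewrite ltn_add2l.
  apply: proper_card; apply/properP; split.
    apply: finset.setDS; rewrite -XYE; apply: finset.setSU; exact: finset.subsetUr.
  by exists f; rewrite -?XYE !inE ?fC ?eqxx // negb_or fX fY.
have [[f [y [fC fXY fU yXY yf]]]|closed] := pselect (exists f y,
    [/\ f \in C, f \notin X :|: Y, f \notin U, y \in a |: (X :|: Y) & e y f]).
  move: fXY; rewrite finset.in_setU negb_or => /andP[fX fY].
  move: yXY; rewrite !inE => /or3P[/eqP ya|yX|yY].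
  - by apply: (grow X Y f y) => //; rewrite !inE ya eqxx.
  - by apply: (grow X Y f y) => //; rewrite !inE yX orbT.
  - apply: (grow Y X f y) => //; first exact: partial_linkage_sym.
      exact: finset.setUC.
    by rewrite !inE yY orbT.
have [z [zB zq az]] := no_cut (fintype.subsetP (pl_UC L) _ (pl_q L)).
have step X' Y' u v : partial_linkage X' Y' U q -> X' :|: Y' = X :|: Y ->
    u \in U -> u != q -> v \in a |: X' -> e v u -> linkage.
  move=> L' XYE uU uq vX vu.
  have [Y'' [U' [q' [L'' [ltU sY]]]]] := partial_linkage_step L' vX uU uq vu.
  apply: (IH _ _ _ _ _ L''); rewrite -ltnS; apply: leq_trans leq_n.
  rewrite -addSn leq_add //; apply: subset_leq_card; apply: finset.setDS.
  by rewrite -XYE; apply: finset.setUS.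
suff: z \in a |: (X :|: Y) \/ exists u v,
    [/\ u \in U, u != q, v \in a |: (X :|: Y) & e v u].
  case=> [|[u [v [uU uq vXY vu]]]].
    rewrite !inE => /or3P[/eqP za|zX|zY].
    - by move: aC; rewrite -za (fintype.subsetP BC).
    - exact: partial_linkage_done L zX zB.
    - exact: partial_linkage_done (partial_linkage_sym L) zY zB.
  move: vXY; rewrite !inE => /or3P[/eqP va|vX|vY].
  - by apply: (step X Y u v) => //; rewrite !inE va eqxx.
  - by apply: (step X Y u v) => //; rewrite !inE vX orbT.
  - apply: (step Y X u v) => //; first exact: partial_linkage_sym.
      exact: finset.setUC.
    by rewrite !inE vY orbT.
(* The path is followed backwards from [z] to [a], in search of an edge leaving [a |: (X :|: Y)]. *)
move: az; rewrite conn_sym // => az; move: z az {zB zq}; apply: conn_ind.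
  by left; rewrite !inE eqxx.
move=> u v uC vC uv [vXY|]; last by right.
have [uXY|uXY] := boolP (u \in a |: (X :|: Y)); first by left.
right; exists u, v.
move: uC uXY; rewrite !inE negb_or; case: eqP => //= _ /andP[uq uC] uXY.
split; rewrite ?(e_sym v) ?inE //; last by move: vXY; rewrite !inE.
apply/negPn/negP => uU; apply: closed; exists u, v.
split=> //; last by rewrite e_sym.
by rewrite finset.in_setU.
Qed.

End Linkage.

(** * The game *)

Section Separator.
Variables (T : finType) (e : rel T).
Hypothesis e_sym : symmetric e.

Local Notation conn := (conn e).
Local Notation component := (component e).
Local Notation connected_set := (connected_set e).
Local Notation boundary := (boundary e).

Lemma boundaryP (C : {set T}) x :
  reflect (x \notin C /\ exists2 y, y \in C & e x y) (x \in boundary C).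
Proof.
rewrite inE; apply: (iffP andP) => -[xC H]; split=> //.
  by case/exists_inP: H => y; exists y.
by apply/exists_inP.
Qed.

(* Excludes a [K4] on [a], [b], [z1], [z2]: the edge [ab] runs in [~: C],
   [z1z2] in [C], [azi] in [a |: Qi], and [bzi] is an edge of the graph. *)
Definition K4_free : Prop :=
  forall (C Q1 Q2 : {set T}) (a b z1 z2 : T),
    a != b -> a \notin C -> b \notin C ->
    connected_set C -> connected_set (~: C) ->
    Q1 \subset C -> Q2 \subset C -> {in Q1, forall x, x \notin Q2} ->
    z1 \in Q1 -> z2 \in Q2 ->
    connected_set (a |: Q1) -> connected_set (a |: Q2) ->
    e z1 b -> e z2 b -> False.

Hypothesis e_K4 : K4_free.

(** If [t] separates [a] from the neighbours of [b], no component of [C :\ t] is adjacent to both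
    [a] and [b]. If no vertex does so, the linkage produces the forbidden [K4]. The edge from
    outside [C] into [C :\: K] serves to keep the complement of [K] connected. *)
Lemma cut_vertex (C : {set T}) a b :
  connected_set C -> connected_set (~: C) -> boundary C = [set a; b] ->
  exists2 t, t \in C & forall r, r \in C :\ t ->
    let K := component (C :\ t) r in
    (exists x y, [/\ x \notin C, y \in C :\: K & e x y]) /\
    (exists2 x, x \in [set a; b] & boundary K \subset [set x; t]).
Proof.
move=> Cc Cc' bC.
have /boundaryP[aC [q qC aq]] : a \in boundary C by rewrite bC !inE eqxx.
have /boundaryP[bC' [q' q'C bq']] : b \in boundary C by rewrite bC !inE eqxx orbT.
have bK t r x : t \in C -> r \in C :\ t -> x \in boundary (component (C :\ t) r) ->
    [\/ x = t, x = a | x = b].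
  move=> tC rC /boundaryP[xK [y yK xy]].
  have : x \notin C :\ t by apply: component_boundary yK xK _; rewrite // e_sym.
  rewrite !inE negb_and negbK => /orP[/eqP|xC]; first by constructor 1.
  suff : x \in boundary C.
    by rewrite bC !inE => /orP[]/eqP; [constructor 2|constructor 3].
  apply/boundaryP; split=> //; exists y => //.
  by have := fintype.subsetP (component_sub _ _ _) _ yK; rewrite !inE => /andP[].
(* With a single boundary vertex, any neighbour of it in [C] can serve as [t]. *)
have [ab|ab] := eqVneq a b.
  exists q => // r rC K; split.
    exists a, q; split=> //; rewrite inE qC andbT; apply/negP => qK.
    by have := fintype.subsetP (component_sub _ _ _) _ qK; rewrite !inE eqxx.
  exists a; first by rewrite !inE eqxx.
  apply/fintype.subsetP => x /(bK _ _ _ qC rC).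
  by rewrite -ab !inE => -[]->; rewrite eqxx ?orbT.
pose B := [set z in C | e b z].
have [[t tC tcut]|no_cut] := pselect (exists2 t, t \in C &
    forall z, z \in B -> z != t -> ~~ conn (a |: (C :\ t)) a z).
  exists t => // r rC K.
  have KC : K \subset C :\ t := component_sub _ _ _.
  have KC' x : x \in K -> x \in C.
    by move=> /(fintype.subsetP KC); rewrite !inE => /andP[].
  have Kt x : x \in K -> x != t.
    by move=> /(fintype.subsetP KC); rewrite !inE => /andP[].
  (* A component adjacent to [a] leaves the neighbour [q'] of [b] outside; one not adjacent to [a]
     leaves [q] outside. *)
  have [[y yK ay]|aK] := pselect (exists2 y, y \in K & e a y).
    have bK' z : z \in K -> ~~ e b z.
      move=> zK; apply/negP=> bz.
      have zB : z \in B by rewrite inE bz KC'.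
      apply: (negP (tcut z zB (Kt _ zK))).
      apply: (@conn_trans _ _ _ y).
        by apply: conn1; rewrite // !inE ?eqxx ?(Kt _ yK) ?(KC' _ yK) ?orbT.
      apply: (@conn_sub _ _ K); last exact: connected_set_component.
      by apply: fintype.subset_trans KC _; apply: finset.subsetUr.
    split.
      exists b, q'; split; rewrite // inE q'C andbT.
      by apply/negP => /bK'; rewrite bq'.
    exists a; first by rewrite !inE eqxx.
    apply/fintype.subsetP => x xK; have [] := bK _ _ _ tC rC xK => [->|->|xb].
    - by rewrite !inE eqxx orbT.
    - by rewrite !inE eqxx.
    - by case/boundaryP: xK => _ [z /bK']; rewrite xb => /negP.
  split.
    exists a, q; split; rewrite // inE qC andbT.
    by apply/negP => qK; apply: aK; exists q.
  exists b; first by rewrite !inE eqxx orbT.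
  apply/fintype.subsetP => x xK; have [] := bK _ _ _ tC rC xK => [->|xa|->].
  - by rewrite !inE eqxx orbT.
  - by case/boundaryP: xK => _ [z zK]; rewrite xa => az; case: aK; exists z.
  - by rewrite !inE eqxx.
exfalso.
have BC : B \subset C by apply/fintype.subsetP => x; rewrite inE => /andP[].
(* The search starts with both paths reduced to [a] and all of [C] in reserve. *)
have L0 : partial_linkage e C B a finset.set0 finset.set0 C q.
  split; rewrite ?finset.sub0set //.
  - by move=> x; rewrite inE.
  - by move=> x; rewrite inE.
  - by move=> x; rewrite inE.
  - by rewrite finset.setU0; apply: connected_set1.
  - by rewrite finset.setU0; apply: connected_set1.
  - by exists a; rewrite // !inE eqxx.
  - by exists a; rewrite // !inE eqxx.
  - by exists q'; rewrite // inE q'C.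
have [|Q1 [Q2 [z1 [z2 [[? ? ?] [[z1Q z1B ?] [z2Q z2B ?]]]]]]] :=
    partial_linkage_extend e_sym aC BC _ (leqnn _) L0.
  move=> t tC; have [//|cut] := pselect (exists z,
    [/\ z \in B, z != t & conn (a |: (C :\ t)) a z]).
  case: no_cut; exists t => // z zB zt; apply/negP=> az; apply: cut.
  by exists z.
move: z1B z2B; rewrite !inE => /andP[_ bz1] /andP[_ bz2].
by apply: (e_K4 ab _ _ Cc Cc' _ _ _ z1Q z2Q); rewrite // e_sym.
Qed.

(** The boundary always contains [t]; if the other candidate [z] is missing from it, the boundary is
    [[set t]], covered by [x = t]. *)
Lemma cut_vertex_component (C : {set T}) a b :
  connected_set C -> connected_set (~: C) -> boundary C = [set a; b] ->
  exists2 t, t \in C & forall r, r \in C :\ t ->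
    connected_set (~: component (C :\ t) r) /\
    exists2 x, x \in [set a; b; t] &
      boundary (component (C :\ t) r) = [set x; t].
Proof.
move=> Cc Cc' bC; have [t tC tP] := cut_vertex Cc Cc' bC; exists t => // r rC.
have [[x [y [xC yK xy]]] [z zab bK]] := tP r rC; set K := component _ r in bK yK *.
have KC : K \subset C.
  by apply: fintype.subset_trans (component_sub _ _ _) (finset.subD1set _ _).
split.
  suff -> : ~: K = ~: C :|: (C :\: K).
    apply: connected_setU Cc' _ _ yK xy => //; last by rewrite inE.
    by apply: (connected_setP e_sym (x := t)) => v; apply: conn_setD_component.
  apply/setP => v; rewrite finset.in_setU finset.in_setD !finset.in_setC.
  have [vC|vC] := boolP (v \in C); first by rewrite andbT.
  by rewrite orTb; apply: contra vC; apply/fintype.subsetP.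
have tK : t \in boundary K.
  apply/boundaryP; split; last exact: component_adj.
  by rewrite !inE eqxx.
have [zK|zK] := boolP (z \in boundary K).
  exists z; first by move: zab; rewrite !inE => ->.
  apply/eqP; rewrite finset.eqEsubset bK /=.
  by apply/fintype.subsetP => v /set2P[]->.
exists t; first by rewrite !inE eqxx orbT.
apply/eqP; rewrite finset.eqEsubset finset.setUid finset.sub1set tK andbT.
apply/fintype.subsetP => v vK; move: (fintype.subsetP bK v vK).
by rewrite !inE => /orP[/eqP vz|//]; move: zK; rewrite -vz vK.
Qed.

End Separator.

(** * Winning positions and the strategy of three cops *)

Section Game.
Variables (T : finType) (e : rel T).

(** Surrounding is replaced by stalemate: a robber without a legal move has cops on his vertex and
    on all its neighbours. The position is taken with the cops to move. *)
Inductive win m (c : 'I_m -> T) (r : T) : Prop :=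
  Win c' of (forall i, move e (c i) (c' i)) &
    (forall r', move e r r' -> (forall i, c' i <> r') -> win c' r').

(* A finitary version of [win], in which the number of rounds decreases along
   the positions visited by any strategy choosing it minimal. *)
Fixpoint win_in m (n : nat) (c : 'I_m -> T) (r : T) : Prop :=
  if n is n'.+1 then
    exists2 c', forall i, move e (c i) (c' i) &
      forall r', move e r r' -> (forall i, c' i <> r') -> win_in n' c' r'
  else False.

Lemma win_inS m n (c : 'I_m -> T) r : win_in n c r -> win_in n.+1 c r.
Proof.
elim: n c r => // n IH c r [c' cc' wc']; exists c' => // r' rr' cr'.
exact/IH/wc'.
Qed.

Lemma win_in_le m n n' (c : 'I_m -> T) r :
  (n <= n')%N -> win_in n c r -> win_in n' c r.
Proof.
by move=> /subnK <-; elim: (n' - n)%N => // k IH /IH; rewrite addSn; apply: win_inS.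
Qed.

(** The robber has finitely many replies, so the numbers of rounds they require have a maximum. *)
Lemma win_win_in m (c : 'I_m -> T) r : win c r -> exists n, win_in n c r.
Proof.
elim=> {}c {}r c' cc' _ IH.
have [f fP] : exists f : T -> nat,
    forall r', move e r r' -> (forall i, c' i <> r') -> win_in (f r') c' r'.
  suff /choice[f fP] : forall r', exists n,
    move e r r' -> (forall i, c' i <> r') -> win_in n c' r' by exists f.
  move=> r'.
  have [rr'|nrr'] := pselect (move e r r' /\ (forall i, c' i <> r')).
    by have [n nP] := IH r' rr'.1 rr'.2; exists n.
  by exists 0%N => rr' cr'; case: nrr'.
exists (\max_r' f r').+1; exists c' => // r' rr' cr'.
by apply: win_in_le (fP r' rr' cr'); apply: leq_bigmax.
Qed.

(** The strategy depends only on the current position: [F] minimises the number of remaining rounds,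
    and folding it over the history gives the positions of the cops. An infinite legal play would
    decrease this number forever. *)
Lemma cops_win_of_win m (c0 : 'I_m -> T) :
  (forall r, win c0 r) -> cops_win e m.
Proof.
move=> win0.
pose good (c : 'I_m -> T) r c' := (forall i, move e (c i) (c' i)) /\
  (forall n, win_in n.+1 c r -> forall r', move e r r' ->
    (forall i, c' i <> r') -> win_in n c' r').
have goodP c r : exists c', good c r c'.
  (* In a position that is not won the default reply is to stand still. *)
  have [w|nw] := pselect (exists n, `[< win_in n c r >]); last first.
    exists c; split=> [i|n wn]; first by rewrite /move eqxx.
    by case: nw; exists n.+1; apply/asboolP.
  case: (ex_minnP w) => -[|n] /asboolP // [c' cc' wc'] n_min.
  exists c'; split=> // n' wn' r' rr' cr'.
  by apply: win_in_le (wc' r' rr' cr'); rewrite -ltnS; apply/n_min/asboolP.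
pose F c r := projT1 (cid (goodP c r)).
have FP c r : good c r (F c r) := projT2 (cid (goodP c r)).
exists (fun h => foldl F c0 h); split=> [h r i|rho play].
  by rewrite foldl_rcons; have [] := FP (foldl F c0 h) r.
exfalso; have [n wn] := win_win_in (win0 (rho 0%N)).
suff : forall k, ~ win_in n (foldl F c0 (mkseq rho k)) (rho k) by move=> /(_ 0%N).
elim: n {wn} => [k []|n IH k wk]; have [mk ck] := play k.
apply: (IH k.+1); move: ck; rewrite mkseqS foldl_rcons => ck.
by have [_] := FP (foldl F c0 (mkseq rho k)) (rho k); apply.
Qed.

Hypothesis e_sym : symmetric e.
Hypothesis e_conn : forall x y : T, connect e x y.
Hypothesis e_K4 : K4_free e.

Lemma connected_setT : connected_set e [set: T].
Proof.
move=> x y _ _; rewrite (_ : conn e _ x y = connect e x y) //.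
by apply: eq_connect => u v; rewrite /induced /= !inE.
Qed.

(** Induction on the size of the territory [C]. Cops [i] and [j], possibly equal, hold its boundary
    while a third one walks through the graph to the cut vertex; the robber is then confined to a
    smaller territory whose boundary is occupied again. *)
Lemma confined_win n (C : {set T}) (c : 'I_3 -> T) r i j :
  (#|C| <= n)%N -> r \in C ->
  connected_set e C -> connected_set e (~: C) ->
  boundary e C = [set c i; c j] -> win c r.
Proof.
elim: n C c r i j => [|n IH] C c r i j.
  by rewrite leqn0 cards_eq0 => /eqP->; rewrite inE.
move=> leCn rC Cc Cc' bC.
have [t tC tP] := cut_vertex_component e_sym e_K4 Cc Cc' bC.
have [k /andP[ki kj]] : exists k : 'I_3, (k != i) && (k != j).
  apply/existsP; apply: contraT; rewrite negb_exists => /forallP H.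
  have : [set: 'I_3] \subset [set i; j].
    apply/fintype.subsetP => k _; move: (H k).
    by rewrite negb_and !negbK !inE.
  move=> /subset_leq_card; rewrite cardsT card_ord cards2.
  by case: (_ != _).
have stay c' r' : c' i = c i -> c' j = c j -> forall s, r' \in C -> move e r' s ->
    (forall l, c' l <> s) -> s \in C.
  move=> ci cj s r'C /orP[/eqP<-//|r's] c's; apply: contraT => sC.
  have : s \in boundary e C.
    by apply/boundaryP; split=> //; exists r'; rewrite // e_sym.
  by rewrite bC -ci -cj => /set2P[sE|sE]; case: (c's _ (esym sE)).
suff walk u : connect e u t -> forall c' r', c' i = c i -> c' j = c j ->
    c' k = u -> r' \in C -> win c' r'.
  exact: (walk (c k)).
move: u; apply: connect_ind_left =>
  [c' r' ci cj ck r'C|u v uv IHv c' r' ci cj ck r'C].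
  (* One idle round with cop [k] on [t]: a robber standing on [t] has to leave it. *)
  exists c' => [l|s r's c's]; first by rewrite /move eqxx.
  have sC := stay _ _ ci cj _ r'C r's c's.
  have st : s != t by apply/eqP => st; apply: (c's k); rewrite ck.
  have sCt : s \in C :\ t by rewrite !inE st.
  have [Kc [x xabt bK]] := tP s sCt.
  have [i' xi'] : exists i', x = c' i'.
    move: xabt; rewrite !inE -ci -cj -ck -orbA => /or3P[]/eqP->;
    by [exists i|exists j|exists k].
  apply: (IH (component e (C :\ t) s) _ _ i' k) => //.
  - rewrite -ltnS; apply: leq_trans leCn; apply: leq_ltn_trans (_ : #|C :\ t| < _)%N.
      by apply/subset_leq_card/component_sub.
    by rewrite (cardsD1 t C) tC.
  - exact: mem_component.
  - exact: connected_set_component.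
  - by rewrite bK xi' ck.
pose c'' l := if l == k then v else c' l.
have ci'' : c'' i = c i by rewrite /c'' eq_sym (negPf ki).
have cj'' : c'' j = c j by rewrite /c'' eq_sym (negPf kj).
exists c'' => [l|s r's c's].
  rewrite /c''; case: eqP => [->|_]; last by rewrite /move eqxx.
  by rewrite ck /move uv orbT.
apply: IHv => //; first by rewrite /c'' eqxx.
exact: (stay c'' r').
Qed.

Lemma cops_win3 : (0 < #|T|)%N -> cops_win e 3.
Proof.
move=> /card_gt0P[v0 _]; apply: (@cops_win_of_win _ (fun=> v0)) => r.
(* The robber may be placed on [v0] initially, so the cops first wait one round there. *)
exists (fun=> v0) => [i|s _ /(_ ord0)/nesym/eqP sv0]; first by rewrite /move eqxx.
have sT : s \in [set: T] :\ v0 by rewrite !inE sv0.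
have v0T : v0 \in [set: T] by rewrite inE.
apply: (@confined_win _ (component e ([set: T] :\ v0) s) _ _ ord0 ord0 (leqnn _)).
- exact: mem_component.
- exact: connected_set_component.
- rewrite -finset.setTD; apply: (connected_setP e_sym (x := v0)) => v vK.
  by apply: conn_setD_component; rewrite //; apply: connected_setT.
apply/setP => x; apply/boundaryP/set2P => [[xK [y yK xy]]|].
  have : x \notin [set: T] :\ v0.
    by apply: component_boundary yK xK _; rewrite // e_sym.
  by rewrite !inE andbT negbK => /eqP->; left.
move=> xv0; have -> : x = v0 by case: xv0.
split; first by rewrite !inE eqxx.
by have [y yK v0y] := component_adj e_sym connected_setT v0T sT; exists y.
Qed.

Lemma surrounding_cop_number_le3 : (surrounding_cop_number e <= 3)%N.
Proof.
rewrite /surrounding_cop_number; case: ex_minnP => m _ m_min.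
(* On the empty graph there is no play at all, and zero cops win. *)
have [T0|/cops_win3 win3] := posnP #|T|; last by apply/m_min/asboolP.
apply: leq_trans (m_min 0%N _) _ => //; apply/asboolP.
exists (fun _ (i : 'I_0) => False_rect T (notF (ltn_ord i))).
split=> [h r []//|rho _].
by have := max_card (pred1 (rho 0%N)); rewrite T0 card1.
Qed.

End Game.

Import Order.TTheory GRing.Theory Num.Theory.
Import numFieldNormedType.Exports.

(** * Crossing parities *)

Section Chains.
Variable P : Type.
Implicit Types r : P -> P -> Prop.

Fixpoint walk r (x : P) (s : seq P) : Prop :=
  if s is y :: s' then r x y /\ walk r y s' else True.

Definition chain r (x y : P) (s : seq P) : Prop := walk r x s /\ last x s = y.

Definition chained r (x y : P) : Prop := exists s, chain r x y s.

Lemma chained0 r x : chained r x x.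
Proof. by exists [::]. Qed.

Lemma chained1 r x y : r x y -> chained r x y.
Proof. by exists [:: y]. Qed.

Lemma chained_trans r y x z : chained r x y -> chained r y z -> chained r x z.
Proof.
move=> [s [xs <-]] [t [st <-]]; exists (s ++ t); split; last by rewrite last_cat.
by elim: s x xs st => [|u s IH] x //= [xu us] st; split=> //; apply: IH.
Qed.

Lemma sub_chained r r' x y : (forall u v, r u v -> r' u v) ->
  chained r x y -> chained r' x y.
Proof.
move=> rr' [s [xs <-]]; exists s; split=> //.
by elim: s x xs => [|u s IH] x //= [xu us]; split; [apply: rr'|apply: IH].
Qed.

End Chains.

Section Crossings.
Variable R : realType.
Implicit Types u v w x y a b q : (R * R)%type.
Local Open Scope ring_scope.

(** A half-plane with half of its boundary line: of [u] and [- u] exactly one belongs to it when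
    [u != 0], so points on the axis need no special treatment. *)
Definition upper u : bool := (0 < u.2) || ((u.2 == 0) && (0 < u.1)).

(* Whether the segment from [u] to [v] crosses the negative half of the first
   axis; only meaningful if [u] and [v] lie in a common open half-plane bounded
   by one of the axes. *)
Definition crosses u v : bool := (upper u (+) upper v) && (u.1 < 0).

(** All points lie in one of four open half-planes bounded by the axes; in particular their convex
    hull misses the origin. *)
Definition common_side (s : seq (R * R)) : bool :=
  [|| all (fun u => 0 < u.1) s, all (fun u => u.1 < 0) s,
      all (fun u => 0 < u.2) s | all (fun u => u.2 < 0) s].

(** Parity of the crossings of the chain with the horizontal half-line going left from [q]. *)
Fixpoint crossings (x : R * R) (s : seq (R * R)) (q : R * R) : bool :=
  if s is y :: s' then crosses (x - q) (y - q) (+) crossings y s' q else false.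

(** Discrete disjointness: each cell of the grid of differences [a - b] stays on one side of the
    origin. *)
Definition separated (r r' : R * R -> R * R -> Prop) : Prop :=
  forall a a' b b', r a a' -> r' b b' ->
    common_side [:: a - b; a' - b; a - b'; a' - b'].

Lemma upperN u : u != 0 -> upper (- u) = ~~ upper u.
Proof.
case: u => u1 u2 u0; rewrite /upper /= !oppr_gt0 oppr_eq0.
have [//|//|u20] := ltgtP u2 0; rewrite /=.
have [//|//|u10] := ltgtP u1 0.
by move: u0; rewrite u10 u20 eqxx.
Qed.

Lemma upper_pos u : 0 < u.2 -> upper u.
Proof. by rewrite /upper => ->. Qed.

Lemma upper_neg u : u.2 < 0 -> upper u = false.
Proof. by rewrite /upper => u0; rewrite lt_gtF // lt_eqF. Qed.

(** In the left half-plane a crossing is a change of [upper], and these cancel around the cell; in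
    the other three half-planes nothing crosses. *)
Lemma crosses_cell u v w x : common_side [:: u; v; w; x] ->
  crosses u v (+) crosses w x = crosses u w (+) crosses v x.
Proof.
rewrite /crosses => /or4P[] /= /and5P[Hu Hv Hw Hx _].
- by rewrite !(lt_gtF Hu, lt_gtF Hv, lt_gtF Hw) !andbF.
- rewrite Hu Hv Hw !andbT.
  by case: (upper u) (upper v) (upper w) (upper x) => [] [] [] [].
- by rewrite !(upper_pos Hu, upper_pos Hv, upper_pos Hw, upper_pos Hx).
- by rewrite !(upper_neg Hu, upper_neg Hv, upper_neg Hw, upper_neg Hx).
Qed.

Lemma common_side_neq0 u s : common_side s -> u \in s -> u != 0.
Proof.
move=> us uin; apply: contraTneq us => u0; rewrite u0 in uin.
by apply/negP => /or4P[] /allP/(_ _ uin); rewrite /= ltxx.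
Qed.

(** Negation exchanges the two halves of the first axis, and [upper] changes exactly when one of
    them is crossed. *)
Lemma crossesN u v : common_side [:: u; v] ->
  crosses (- u) (- v) = crosses u v (+) (upper u (+) upper v).
Proof.
move=> uv; have [u0 v0] : u != 0 /\ v != 0.
  by split; apply: common_side_neq0 uv _; rewrite !inE eqxx ?orbT.
rewrite /crosses !upperN // addNb addbN negbK /=.
case/or4P: uv => /and3P[Hu Hv _].
- by rewrite oppr_lt0 Hu (lt_gtF Hu) andbT andbF.
- by rewrite oppr_lt0 Hu (lt_gtF Hu) andbT andbF addbb.
- by rewrite (upper_pos Hu) (upper_pos Hv).
- by rewrite (upper_neg Hu) (upper_neg Hv).
Qed.

Lemma common_side_sub s s' : {subset s' <= s} -> common_side s -> common_side s'.
Proof.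
move=> ss' /or4P[] /allP H; rewrite /common_side; apply/or4P;
  by [constructor 1; apply/allP => x /ss'/H | constructor 2; apply/allP => x /ss'/H
    | constructor 3; apply/allP => x /ss'/H | constructor 4; apply/allP => x /ss'/H].
Qed.

Lemma common_sideN s : common_side s -> common_side [seq - u | u <- s].
Proof.
rewrite /common_side !all_map => /or4P[] sP; apply/or4P.
- by constructor 2; apply: sub_all sP => u /=; rewrite oppr_lt0.
- by constructor 1; apply: sub_all sP => u /=; rewrite oppr_gt0.
- by constructor 4; apply: sub_all sP => u /=; rewrite oppr_lt0.
- by constructor 3; apply: sub_all sP => u /=; rewrite oppr_gt0.
Qed.

Lemma crossings_strip r x s b b' : walk r x s ->
  (forall a a', r a a' -> common_side [:: a - b; a' - b; a - b'; a' - b']) ->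
  crossings x s b (+) crossings x s b' =
  crosses (x - b) (x - b') (+) crosses (last x s - b) (last x s - b').
Proof.
move=> + rb; elim: s x => [|y s IH] x /=; first by rewrite addbb.
case=> xy ys; rewrite addbACA (IH _ ys) (crosses_cell (rb _ _ xy)).
by rewrite -addbA addKb.
Qed.

Lemma addb_grid (A A' L c1 c2 t1 t2 u1 u1' u2 u2' w1 w2 : bool) :
  A (+) A' = c1 (+) (u1 (+) u1') (+) (c2 (+) (u2 (+) u2')) ->
  A' (+) L (+) (t1 (+) t2) = u1' (+) w1 (+) (u2' (+) w2) ->
  A (+) L (+) (c1 (+) t1 (+) (c2 (+) t2)) = u1 (+) w1 (+) (u2 (+) w2).
Proof.
rewrite !(addbACA c1 _ c2) (addbACA u1 u1') (addbACA u1') (addbACA u1 w1).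
move: (c1 (+) c2) (t1 (+) t2) (u1 (+) u2) (u1' (+) u2') (w1 (+) w2).
by move: A A' L => [] [] [] [] [] [] [] [].
Qed.

(** The strips are summed over the steps of [t]. Along the two sides parallel to [t], [crossesN]
    turns the differences around into crossings with half-lines from [x] and [last x s]; its
    corrections telescope to the four corners. *)
Lemma crossings_grid r r' x s y t : walk r x s -> walk r' y t -> separated r r' ->
  s <> [::] ->
  crossings x s y (+) crossings x s (last y t) (+)
  (crossings y t x (+) crossings y t (last x s)) =
  upper (y - x) (+) upper (last y t - x) (+)
  (upper (y - last x s) (+) upper (last y t - last x s)).
Proof.
(* The first and last steps of [s] are extracted because [separated] speaks of [x] and [last x s]
   only through steps. *)
move=> xs + rr' s0; have [x1 xx1] : exists x1, r x x1.
  by case: s xs s0 => [//|x1 s] /= [xx1 _] _; exists x1.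
have [x2 x2l] : exists x2, r x2 (last x s).
  elim: s x xs s0 {xx1} => [//|z [|w s] IH] x /= [xz zs] _; first by exists x.
  by apply: (IH z).
elim: t y => [|y' t IH] y /=; first by rewrite !addbb.
case=> yy' /IH E; have := crossings_strip xs (fun a a' aa' => rr' _ _ _ _ aa' yy').
have side a a' : r a a' ->
    common_side [:: y - a; y' - a] /\ common_side [:: y - a'; y' - a'].
  move=> /rr'/(_ yy')/common_sideN; rewrite /= !opprB => ss.
  by split; apply: common_side_sub ss => u; rewrite !inE => /orP[]->; rewrite ?orbT.
have [/crossesN E1 _] := side _ _ xx1; have [_ /crossesN E2] := side _ _ x2l.
rewrite !opprB in E1 E2; rewrite E1 E2 => strip.
exact: addb_grid strip E.
Qed.

Lemma addb_parity (a b c d a' b' c' d' : bool) :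
  a (+) b (+) (c (+) d) = a' (+) b' (+) (c' (+) d') ->
  exists k : nat, (a + b + (c + d) + (a' + b' + (c' + d')) = k + k)%N.
Proof.
move=> H; exists ((a + b + (c + d) + (a' + b' + (c' + d')))./2)%N.
rewrite addnn -[LHS]odd_double_half -[RHS]add0n; congr (_ + _)%N.
by rewrite !oddD !oddb H addbb.
Qed.

(* For [i < j], [r i j] is the step relation of the chain drawing the edge
   [ij]. *)
Lemma K5_not_separated (v : nat -> R * R)
    (r : nat -> nat -> R * R -> R * R -> Prop) :
  (forall i j, i < j < 5 -> v i != v j)%N ->
  (forall i j, i < j < 5 -> chained (r i j) (v i) (v j))%N ->
  (forall i j k l, i < j < 5 -> k < l < 5 -> i < k -> j != k -> j != l ->
    separated (r i j) (r k l))%N -> False.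
Proof.
move=> v_neq r_chain r_sep.
have /choice[s sP] i : exists s : nat -> seq (R * R),
    forall j, (i < j < 5)%N -> chain (r i j) (v i) (v j) (s j).
  have /choice[s sP] : forall j, exists s,
      (i < j < 5)%N -> chain (r i j) (v i) (v j) s.
    move=> j; have [ij|] := boolP (i < j < 5)%N; last by exists [::].
    by have [s ?] := r_chain i j ij; exists s.
  by exists s.
pose X i j k := crossings (v i) (s i j) (v k).
pose H i j := upper (v j - v i).
have HN i j : (i < j < 5)%N -> H j i = ~~ H i j.
  by move=> ij; rewrite /H -opprB upperN // subr_eq0 eq_sym v_neq.
have E i j k l : (i < j < 5)%N -> (k < l < 5)%N -> (i < k)%N -> j != k -> j != l ->
    X i j k (+) X i j l (+) (X k l i (+) X k l j) =
    H i k (+) H i l (+) (H j k (+) H j l).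
  move=> ij kl ik jk jl; have [sw sl] := sP i j ij; have [tw tl] := sP k l kl.
  have /(crossings_grid sw tw) := r_sep i j k l ij kl ik jk jl.
  rewrite sl tl; apply=> s0; move: sl (v_neq i j ij).
  by rewrite s0 /= => ->; rewrite eqxx.
(* Booleans become integers 0 and 1, and congruence modulo 2 becomes being twice an integer, which
   [lia] can handle. *)
have [x [h [xP hP]]] : exists (x : nat -> nat -> nat -> int) (h : nat -> nat -> int),
    (forall i j k l, (i < j < 5)%N -> (k < l < 5)%N -> (i < k)%N ->
      j != k -> j != l ->
      exists n, x i j k + x i j l + (x k l i + x k l j) +
        (h i k + h i l + (h j k + h j l)) = n + n) /\
    (forall i j, (i < j < 5)%N -> h i j + h j i = 1).
  exists (fun i j k => X i j k : nat), (fun i j => H i j : nat).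
  split=> [i j k l ij kl ik jk jl|i j ij].
    have [n nE] := addb_parity (E i j k l ij kl ik jk jl).
    by exists (Posz n); rewrite -!PoszD nE.
  by rewrite (HN i j ij); case: (H i j).
(* Each [x i j k] occurs in two relations and each unordered pair in six terms of [h]. Of these 60
   terms, 15 have decreasing indices, which leaves an odd constant. *)
have [? ?] := xP 0 1 2 3 isT isT isT isT isT.
have [? ?] := xP 0 1 2 4 isT isT isT isT isT.
have [? ?] := xP 0 1 3 4 isT isT isT isT isT.
have [? ?] := xP 0 2 1 3 isT isT isT isT isT.
have [? ?] := xP 0 2 1 4 isT isT isT isT isT.
have [? ?] := xP 0 2 3 4 isT isT isT isT isT.
have [? ?] := xP 0 3 1 2 isT isT isT isT isT.
have [? ?] := xP 0 3 1 4 isT isT isT isT isT.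
have [? ?] := xP 0 3 2 4 isT isT isT isT isT.
have [? ?] := xP 0 4 1 2 isT isT isT isT isT.
have [? ?] := xP 0 4 1 3 isT isT isT isT isT.
have [? ?] := xP 0 4 2 3 isT isT isT isT isT.
have [? ?] := xP 1 2 3 4 isT isT isT isT isT.
have [? ?] := xP 1 3 2 4 isT isT isT isT isT.
have [? ?] := xP 1 4 2 3 isT isT isT isT isT.
have h01 := hP 0 1 isT.
have h02 := hP 0 2 isT.
have h03 := hP 0 3 isT.
have h04 := hP 0 4 isT.
have h12 := hP 1 2 isT.
have h13 := hP 1 3 isT.
have h14 := hP 1 4 isT.
have h23 := hP 2 3 isT.
have h24 := hP 2 4 isT.
have h34 := hP 3 4 isT.
lia.
Qed.

End Crossings.

(** * Chains in the plane *)

Section ChainConnectivity.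
Local Open Scope classical_set_scope.

(** The points of [U] related to [x] form a nonempty subset that is open and closed in [U]. *)
Lemma connected_locally_related (P : topologicalType) (U : set P)
    (E : P -> P -> Prop) :
  connected U -> (forall x, E x x) ->
  (forall y x z, E x y -> E y z -> E x z) ->
  (forall x, U x -> \forall z \near x, U z -> E x z /\ E z x) ->
  forall x y, U x -> U y -> E x y.
Proof.
move=> Uc E0 Et Eloc x y Ux Uy.
suff : [set z | U z /\ E x z] = U by move=> /seteqP[_ /(_ y Uy)[]].
apply: Uc; first by exists x; split.
  exists [set z | U z -> E x z]°; first exact: open_interior.
  apply/seteqP; split=> z [Uz xz]; split=> //; last exact: (interior_subset xz).
  by near=> w => Uw; apply: Et xz _; apply (near (Eloc z Uz) w).
exists (~` [set z | U z -> ~ E x z]°); first exact/open_closedC/open_interior.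
apply/seteqP; split=> z [Uz xz]; split=> //; first by move=> /interior_subset/(_ Uz).
apply: contrapT => nxz; apply: xz; near=> w => Uw xw.
by apply: nxz; apply: Et xw _; apply (near (Eloc z Uz) w).
Unshelve. all: by end_near.
Qed.

Lemma compact_disjoint_distance (R : realType) (V : normedModType R) (A B : set V) :
  compact A -> closed B -> A `&` B = set0 ->
  \forall d \near (0 : R)^'+, forall a b, A a -> B b -> (d <= `|a - b|)%R.
Proof.
move=> /compact_near_coveringP Ac Bc AB0.
suff H : \forall d \near (0 : R)^'+,
    A `<=` [set a | forall b, B b -> (d <= `|a - b|)%R].
  by apply: filterS H => d H a b /H; apply.
apply: Ac => a Aa; have /nbhs_ballP[r /= r0 rB] : nbhs a (~` B).
  apply: open_nbhs_nbhs; split; first exact: closed_openC.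
  by move=> Ba; have : (A `&` B) a by []; rewrite AB0.
have r20 : (0 < r / 2)%R by rewrite divr_gt0.
exists (ball a (r / 2), [set d | d < r / 2])%R.
  by split; [exact: nbhsx_ballx | exact: nbhs_right_lt].
move=> [a' d] /= []; rewrite -ball_normE /= => aa' dr b Bb.
have rab : (r <= `|a - b|)%R.
  by rewrite leNgt; apply/negP => ab; apply: (rB b) Bb; rewrite -ball_normE.
have := ler_distD a' a b; lra.
Qed.

End ChainConnectivity.

(** * Chains that avoid a closed set and lead to a far point *)

Section Reach.
Variable R : realType.
Implicit Types (a b x y z : (R * R)%type) (D U : set (R * R)).
Local Open Scope ring_scope.
Local Open Scope classical_set_scope.

Lemma normr_coord x : `|x.1| <= `|x| /\ `|x.2| <= `|x|.
Proof. by rewrite /Num.norm /= !le_max !lexx orbT. Qed.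

(** In the maximum norm some coordinate of [a - b] has absolute value at least [d]; changes below
    [d / 4] in [a] and in [b] preserve its sign. *)
Lemma common_side_norm a a' b b' d :
  d <= `|a - b| -> `|a - a'| < d / 4 -> `|b - b'| < d / 4 ->
  common_side [:: a - b; a' - b; a - b'; a' - b'].
Proof.
move=> dab aa' bb'.
have [a1 a2] := normr_coord (a - a'); have [b1 b2] := normr_coord (b - b').
have {}a1 := le_lt_trans a1 aa'; have {}a2 := le_lt_trans a2 aa'.
have {}b1 := le_lt_trans b1 bb'; have {}b2 := le_lt_trans b2 bb'.
have : d <= `|(a - b).1| \/ d <= `|(a - b).2|.
  by move: dab; rewrite {1}/Num.norm /= le_max => /orP.
move: a1 a2 b1 b2 {dab aa' bb'}; rewrite /common_side /= !ltr_norml.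
move=> /andP[? ?] /andP[? ?] /andP[? ?] /andP[? ?] H.
have d0 : 0 < d by lra.
apply/or4P; case: H; rewrite ler_normr => /orP[] ?;
  [constructor 1|constructor 2|constructor 3|constructor 4];
  by rewrite !andbT; do ![apply/andP; split]; lra.
Qed.

Definition away D (d : R) a a' : Prop :=
  forall b b', D b -> D b' -> `|b - b'| < d ->
    common_side [:: a - b; a' - b; a - b'; a' - b'].

(* The points of such a chain may come ever closer to [D] as [d] decreases;
   no lower bound on their distance to [D] is required. *)
Definition reach D x y : Prop :=
  \forall d \near (0 : R)^'+, chained (away D d) x y.

Lemma reach_refl D x : reach D x x.
Proof. by near=> d; exact: chained0. Unshelve. all: by end_near. Qed.

Lemma reach_trans D y x z : reach D x y -> reach D y z -> reach D x z.
Proof. by apply: filterS2 => d; apply: chained_trans. Qed.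

Lemma reach_antitone D D' x y : D' `<=` D -> reach D x y -> reach D' x y.
Proof.
move=> sD; apply: filterS => d; apply: sub_chained => u v uv b b' /sD Db /sD Db'.
exact: uv.
Qed.

Lemma reach_near D x : closed D -> ~ D x ->
  \forall z \near x, reach D x z /\ reach D z x.
Proof.
move=> Dc Dx; have /nbhs_ballP[r /= r0 rD] : nbhs x (~` D).
  by apply: open_nbhs_nbhs; split=> //; exact: closed_openC.
have r20 : 0 < r / 2 / 4 by rewrite !divr_gt0.
have rx z : ball x (r / 2 / 4) z -> forall b, D b -> r / 2 <= `|z - b|.
  rewrite -ball_normE /= => xz b Db.
  have : r <= `|x - b|.
    by rewrite leNgt; apply/negP => xb; apply: (rD b) Db; rewrite -ball_normE.
  have := ler_distD z x b; lra.
near=> z; have xz : ball x (r / 2 / 4) z by near: z; exact: nbhsx_ballx.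
have xz' : `|x - z| < r / 2 / 4 by move: xz; rewrite -ball_normE.
split; near=> d; apply: chained1 => b b' Db Db' bb';
  apply: (@common_side_norm _ _ _ _ (r / 2)) => //.
- by apply: rx => //; exact: ballxx.
- by apply: lt_trans bb' _; near: d; exact: nbhs_right_lt.
- exact: rx.
- by apply: lt_trans bb' _; near: d; exact: nbhs_right_lt.
Unshelve. all: by end_near. Qed.

Lemma reach_connected D U x y : closed D -> connected U -> U `<=` ~` D ->
  U x -> U y -> reach D x y.
Proof.
move=> Dc Uc UD; apply: connected_locally_related => //.
- exact: reach_refl.
- by move=> *; apply: reach_trans; eassumption.
by move=> z /UD Dz; apply: filterS (reach_near Dc Dz).
Qed.

Lemma reach_segment D x y : closed D ->
  (forall t, 0 <= t <= 1 -> ~ D (x + t *: (y - x))) -> reach D x y.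
Proof.
move=> Dc xyD; pose f t := x + t *: (y - x).
apply: (@reach_connected _ (f @` `[0, 1])) => //.
- apply: connected_continuous_connected; first exact: segment_connected.
  apply: continuous_subspaceT => t.
  by apply: cvgD; [exact: cvg_cst|apply: cvgZr_tmp; exact: cvg_id].
- by move=> _ [t /= + <-]; rewrite in_itv /=; apply: xyD.
- by exists 0; rewrite /= ?in_itv /= ?lexx ?ler01 // /f scale0r addr0.
- by exists 1; rewrite /= ?in_itv /= ?lexx ?ler01 // /f scale1r addrC subrK.
Qed.

(** Here [f] stands for a coordinate or its opposite; the half-plane where it exceeds [B] is convex
    and misses [D]. *)
Lemma reach_halfplane D B (f : R * R -> R) x y : closed D ->
  (forall b, D b -> `|b| <= B) ->
  (forall u v t, f (u + t *: (v - u)) = f u + t * (f v - f u)) ->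
  (forall u, f u <= `|u|) -> B < f x -> B < f y -> reach D x y.
Proof.
move=> Dc DB flin f_le Bx By; apply: reach_segment => // t /andP[t0 t1] /DB.
rewrite leNgt => /negP; apply; apply: lt_le_trans (f_le _); rewrite flin.
have [->|t_neq0] := eqVneq t 0; first by rewrite mul0r addr0.
have : 0 < t * (f y - B) by rewrite mulr_gt0 ?subr_gt0 // lt_def t_neq0.
have : 0 <= (1 - t) * (f x - B) by rewrite mulr_ge0 ?subr_ge0 // ltW.
lra.
Qed.

(** The outside of a square is covered by four half-planes, and neighbouring ones share a corner
    point through which the chain can turn. *)
Lemma reach_far D B w : closed D -> 0 <= B -> (forall b, D b -> `|b| <= B) ->
  B < `|w| -> reach D w (B + 1, B + 1).
Proof.
move=> Dc B0 DB; pose half f x y := @reach_halfplane D B f x y Dc DB.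
have right x y : B < x.1 -> B < y.1 -> reach D x y.
  apply: half => // u; exact: le_trans (ler_norm _) (normr_coord u).1.
have top x y : B < x.2 -> B < y.2 -> reach D x y.
  apply: half => // u; exact: le_trans (ler_norm _) (normr_coord u).2.
have left x y : x.1 < - B -> y.1 < - B -> reach D x y.
  rewrite ![_ < - B]ltrNr; apply: (half (fun u => - u.1)) => [u v t|u] /=.
    by rewrite -[(_ *: _)]/(t * (v.1 - u.1)); lra.
  by apply: le_trans (normr_coord u).1; rewrite -normrN ler_norm.
have bottom x y : x.2 < - B -> y.2 < - B -> reach D x y.
  rewrite ![_ < - B]ltrNr; apply: (half (fun u => - u.2)) => [u v t|u] /=.
    by rewrite -[(_ *: _)]/(t * (v.2 - u.2)); lra.
  by apply: le_trans (normr_coord u).2; rewrite -normrN ler_norm.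
have B1 : B < B + 1 by rewrite ltrDl.
have NB1 : - B - 1 < - B by rewrite gtrDl.
rewrite {1}/Num.norm /= lt_max !ltr_normr => /orP[] /orP[] Bw.
- exact: right.
- apply: (@reach_trans _ (- B - 1, B + 1)); last exact: top.
  by apply: left => //; rewrite ltrNr.
- exact: top.
- apply: (@reach_trans _ (B + 1, - B - 1)); last exact: right.
  by apply: bottom => //; rewrite ltrNr.
Qed.

(** The component of [q] is unbounded, hence contains a point beyond any bound for [D]. *)
Lemma reach_exterior D : compact D ->
  exists2 o, ~ D o & forall q, exterior_face D q -> reach D q o.
Proof.
move=> Dk; have Dc : closed D by exact: (compact_closed (@norm_hausdorff _ _) Dk).
have [B [B0 DB]] : exists B, 0 <= B /\ forall b, D b -> `|b| <= B.
  have [B [_ BD]] := compact_bounded Dk; exists (`|B| + 1).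
  split; first by rewrite addr_ge0.
  by apply: BD; rewrite (le_lt_trans (ler_norm B)) // ltrDl.
exists (B + 1, B + 1) => [/DB|q [Dq qunb]].
  have /= := (normr_coord (B + 1, B + 1)).1; have := ler_norm (B + 1); lra.
have [w qw Bw] : exists2 w : R * R, connected_component (~` D) q w & B < `|w|.
  apply: contrapT => nw; apply: qunb; exists B; split; first exact: num_real.
  move=> M BM w qw; rewrite /= leNgt; apply/negP => Mw; apply: nw; exists w => //.
  exact: lt_trans BM Mw.
apply: reach_trans _ (reach_far Dc B0 DB Bw).
apply: (@reach_connected D _ q w Dc (@component_connected _ (~` D) q) _ _ qw).
  exact: connected_component_sub.
exact: connected_component_refl.
Qed.

End Reach.

(** * Chains inside disjoint compact sets *)

Section Separation.
Variable R : realType.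
Local Open Scope ring_scope.
Local Open Scope classical_set_scope.

Definition near_in (A : set (R * R)) (d : R) (a a' : (R * R)%type) : Prop :=
  [/\ `|a - a'| < d, A a & A a'].

Lemma separated_sym (r r' : R * R -> R * R -> Prop) :
  separated r r' -> separated r' r.
Proof.
move=> rr' a a' b b' aa' bb'; have := common_sideN (rr' _ _ _ _ bb' aa').
rewrite /= !opprB; apply: common_side_sub => u.
by rewrite !inE => /or4P[]->; rewrite ?orbT.
Qed.

Lemma near_in_separated (A B : set (R * R)) :
  compact A -> compact B -> A `&` B = set0 ->
  \forall d \near (0 : R)^'+, separated (near_in A d) (near_in B d).
Proof.
move=> Ac Bc AB0.
have Bcl : closed B by exact: (compact_closed (@norm_hausdorff _ _) Bc).
have [d0 [d00 AB]] := filter_ex (filterI (nbhs_right_gt (0 : R))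
  (compact_disjoint_distance Ac Bcl AB0)).
have d04 : 0 < d0 / 4 by rewrite divr_gt0.
apply: filterS (nbhs_right_lt d04) => d dd0 a a' b b' [aa' Aa _] [bb' Bb _].
by apply: (@common_side_norm _ _ _ _ _ d0); [exact: AB|exact: lt_trans dd0..].
Qed.

Lemma near_in_away_separated (A D : set (R * R)) d :
  A `<=` D -> separated (away D d) (near_in A d).
Proof. by move=> AD a a' b b' aa' [bb' /AD Db /AD Db']; apply: aa'. Qed.

Lemma chained_near_in (A : set (R * R)) d x y : 0 < d ->
  connected A -> A x -> A y -> chained (near_in A d) x y.
Proof.
move=> d0 Ac; apply: connected_locally_related => //; first exact: chained0.
  exact: chained_trans.
move=> z Az; apply: filterS (nbhsx_ballx z d d0) => w.
rewrite -ball_normE /= => zw Aw.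
by split; apply: chained1; split=> //; rewrite distrC.
Qed.

End Separation.

(** * Drawings of induced subgraphs *)

Section Embedding.
Variables (R : realType) (T : finType) (e : rel T).
Variables (p : T -> R * R) (gamma : T -> T -> set (R * R)).
Hypothesis emb : planar_embedding e p gamma.
Local Open Scope ring_scope.
Local Open Scope classical_set_scope.

Definition arcs (S : {set T}) : set (R * R) :=
  [set q | exists u v, [/\ u \in S, v \in S, e u v & gamma u v q]].

Lemma arc_facts x y : e x y ->
  [/\ connected (gamma x y), compact (gamma x y), gamma x y (p x) & gamma x y (p y)].
Proof.
move=> xy; have [f [fc _ <- <- ->]] := embedding_arc emb xy; split.
- by apply: connected_continuous_connected => //; exact: segment_connected.
- by apply: continuous_compact => //; exact: segment_compact.
- by exists 0; rewrite //= in_itv /= lexx ler01.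
- by exists 1; rewrite //= in_itv /= lexx ler01.
Qed.

Lemma compact_arcs S : compact (arcs S).
Proof.
apply/compact_near_coveringP => I F P FF cov.
have H : \near F, forall uv : T * T, uv.1 \in S -> uv.2 \in S -> e uv.1 uv.2 ->
    gamma uv.1 uv.2 `<=` P F.
  apply: filter_forall => -[u v] /=.
  have [uS|_] := boolP (u \in S); last exact: nearW.
  have [vS|_] := boolP (v \in S); last exact: nearW.
  have [uv|_] := boolP (e u v); last exact: nearW.
  have [_ /compact_near_coveringP Huv _ _] := arc_facts uv.
  have : \near F, gamma u v `<=` P F.
    by apply: Huv => q quv; apply: cov; exists u, v.
  by apply: filterS => i.
by apply: filterS H => i H q [u [v [uS vS uv]]]; apply: (H (u, v)).
Qed.

Lemma compact_drawing : compact (drawing e p gamma).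
Proof.
rewrite (_ : drawing _ _ _ = range p `|` arcs [set: T]%SET).
  apply: compactU; last exact: compact_arcs.
  by apply: finite_compact; apply: finite_image; exact: finite_finset.
congr (_ `|` _); apply/seteqP; split=> q [u [v]].
  by move=> [uv quv]; exists u, v; rewrite !inE.
by move=> [_ _ uv quv]; exists u, v.
Qed.

Lemma arcs_drawing S : arcs S `<=` drawing e p gamma.
Proof. by move=> q [u [v [_ _ uv quv]]]; right; exists u, v. Qed.

Lemma arcs_sub (S S' : {set T}) : S \subset S' -> arcs S `<=` arcs S'.
Proof.
by move=> /fintype.subsetP sSS' q [u [v [uS vS uv quv]]]; exists u, v; rewrite !sSS'.
Qed.

Lemma arcs_vertex (S : {set T}) x : x \notin S -> ~ arcs S (p x).
Proof.
move=> xS [u [v [uS vS uv /(embedding_vertex emb uv)]]].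
by case=> xE; move: xS; rewrite xE ?uS ?vS.
Qed.

(** A common point of two distinct edges is a vertex, and a vertex on an edge is one of its ends; it
    would belong to both sets. *)
Lemma arcs_disjoint (S S' : {set T}) : {in S, forall x, x \notin S'} ->
  arcs S `&` arcs S' = set0.
Proof.
move=> SS'; rewrite -subset0 => q.
move=> [[u [v [uS vS uv quv]]] [u' [v' [uS' vS' uv' quv']]]].
have [z _ zq] : range p q.
  apply: (embedding_cross emb uv uv') => //.
    by move=> [uu' _]; move: (SS' _ uS); rewrite uu' uS'.
  by move=> [uu' _]; move: (SS' _ uS); rewrite uu' vS'.
move: quv quv'; rewrite -zq => /(embedding_vertex emb uv) zuv.
move=> /(embedding_vertex emb uv') zuv'.
have zS : z \in S by case: zuv => ->.
by move: (SS' _ zS); case: zuv' => ->; rewrite ?uS' ?vS'.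
Qed.

Lemma chained_arcs (S : {set T}) d x y : 0 < d -> conn e S x y ->
  chained (near_in (arcs S) d) (p x) (p y).
Proof.
move=> d0; move: x; apply: conn_ind => [|u v uS vS uv]; first exact: chained0.
apply: chained_trans; have [uv_conn _ uvu uvv] := arc_facts uv.
apply: (sub_chained _ (chained_near_in d0 uv_conn uvu uvv)) => a a' [aa' Aa Aa'].
by split=> //; exists u, v.
Qed.

(** The point [p x] is off the drawing of the graph without [x], so a nearby point of the exterior
    face can be reached first. Edges at [x] are no obstacle to this first move. *)
Lemma reach_apex o x :
  (forall q, exterior_face (drawing e p gamma) q -> reach (drawing e p gamma) q o) ->
  closure (exterior_face (drawing e p gamma)) (p x) ->
  reach (arcs (~: [set x]%SET)) (p x) o.
Proof.
move=> ext px; have Dx : ~ arcs (~: [set x]%SET) (p x).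
  by apply: arcs_vertex; rewrite !inE eqxx.
have Dc : closed (arcs (~: [set x]%SET)).
  apply: compact_closed; [exact: norm_hausdorff|exact: compact_arcs].
have [q [/ext qo [xq _]]] := px _ (reach_near Dc Dx).
by apply: reach_trans xq _; apply: reach_antitone qo; exact: arcs_drawing.
Qed.

End Embedding.

(** * The forbidden configuration in an outerplanar drawing *)

Section K4.
Variables (R : realType) (T : finType) (e : rel T).
Hypothesis e_sym : symmetric e.
Local Open Scope ring_scope.
Local Open Scope classical_set_scope.

Lemma outerplanar_K4_free : outerplanar R e -> K4_free e.
Proof.
move=> [p [gamma [emb outer]]] C Q1 Q2 a b z1 z2 ab aC bC Cc Cc' Q1C Q2C Q12
  z1Q z2Q aQ1 aQ2 z1b z2b.
have z1C := fintype.subsetP Q1C _ z1Q; have z2C := fintype.subsetP Q2C _ z2Q.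
have bQ1' : b \notin Q1 by apply: contra bC; apply/fintype.subsetP.
have bQ2' : b \notin Q2 by apply: contra bC; apply/fintype.subsetP.
have z1Q2 := Q12 _ z1Q.
have z2Q1 : z2 \notin Q1 by apply/negP => /Q12; rewrite z2Q.
have az1 : a != z1 by apply: contraNneq aC => ->.
have az2 : a != z2 by apply: contraNneq aC => ->.
have bz1 : b != z1 by apply: contraNneq bC => ->.
have bz2 : b != z2 by apply: contraNneq bC => ->.
have z12 : z1 != z2 by apply: contraNneq z1Q2 => ->.
have [far Dfar ext] := reach_exterior (compact_drawing emb).
pose w := nth a [:: a; b; z1; z2].
(* Index 4, the default of [nth], is the apex of the [K5]. *)
pose v := nth far [:: p a; p b; p z1; p z2].
(* For [i < j < 4], the edge [ij] of the [K5] is drawn inside the arcs of [S i j]. *)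
pose S i j : {set T} := nth finset.set0 (nth [::]
  [:: [:: finset.set0; ~: C; a |: Q1; a |: Q2];
      [:: finset.set0; finset.set0; [set z1; b]%SET; [set z2; b]%SET];
      [:: finset.set0; finset.set0; finset.set0; C]] i) j.
pose r d i j := if j == 4 then away (arcs e gamma (~: [set w i]%SET)) d
  else near_in (arcs e gamma (S i j)) d.
have apex : \forall d \near (0 : R)^'+, forall x,
    chained (away (arcs e gamma (~: [set x]%SET)) d) (p x) far.
  apply: (filter_forall (f := fun x d =>
    chained (away (arcs e gamma (~: [set x]%SET)) d) (p x) far)) => x.
  exact: (reach_apex emb ext (outer x)).
have w_neq i j : (i < j < 4)%N -> w i != w j.
  by case: j i => [|[|[|[|j]]]] [|[|[|i]]]; rewrite ?andbF.
have S_conn i j : (i < j < 4)%N -> conn e (S i j) (w i) (w j).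
  case: j i => [|[|[|[|j]]]] [|[|[|i]]]; rewrite ?andbF //= => _; rewrite /S /w /=.
  - by apply: Cc'; rewrite inE.
  - by apply: aQ1; rewrite !inE ?eqxx ?z1Q ?orbT.
  - by apply: conn1; rewrite ?inE ?eqxx ?orbT // e_sym.
  - by apply: aQ2; rewrite !inE ?eqxx ?z2Q ?orbT.
  - by apply: conn1; rewrite ?inE ?eqxx ?orbT // e_sym.
  - exact: Cc.
have S_vertex : forall i j k, (i < j < 4)%N -> (k < 4)%N ->
    k != i -> k != j -> w k \notin S i j.
  move=> i j k; case: j i => [|[|[|[|j]]]] [|[|[|i]]]; rewrite ?andbF //= => _;
  case: k => [|[|[|[|k]]]] //= _ _ _;
  rewrite /S /w /= !inE ?negb_or ?negbK //; apply/andP; split=> //;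
  by rewrite eq_sym.
have S_disj : forall i j k l, (i < j < 4)%N -> (k < l < 4)%N ->
    (i < k)%N -> j != k -> j != l ->
    {in S i j, forall x, x \notin S k l}.
  move=> i j k l; case: j i => [|[|[|[|j]]]] [|[|[|i]]]; rewrite ?andbF //= => _;
  case: l k => [|[|[|[|l]]]] [|[|[|k]]]; rewrite ?andbF //= => _ _ _ _;
  rewrite /S /= => x; rewrite !inE ?negb_or.
  - by [].
  - case/orP => [/eqP->|xQ]; first by rewrite az2 ab.
    by apply/andP; split; [apply: contraNneq z2Q1 => <-|apply: contraNneq bQ1' => <-].
  - case/orP => [/eqP->|xQ]; first by rewrite az1 ab.
    by apply/andP; split; [apply: contraNneq z1Q2 => <-|apply: contraNneq bQ2' => <-].
have disj_near : forall i j k l, (i < j < 4)%N -> (k < l < 4)%N ->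
    (i < k)%N -> j != k -> j != l ->
    \forall d \near (0 : R)^'+, separated (near_in (arcs e gamma (S i j)) d)
      (near_in (arcs e gamma (S k l)) d).
  move=> i j k l ij kl ik jk jl.
  apply: near_in_separated; [exact: (compact_arcs emb)..|].
  by apply: (arcs_disjoint emb); exact: S_disj.
(* One [d] serves all apex chains and the three pairs of independent edges among the vertices 0 to
   3. *)
have [d [d0 [apex_d [d01 [d02 d03]]]]] := filter_ex (filterI (nbhs_right_gt (0 : R))
  (filterI apex (filterI (disj_near 0 1 2 3 isT isT isT isT isT)
    (filterI (disj_near 0 2 1 3 isT isT isT isT isT)
      (disj_near 0 3 1 2 isT isT isT isT isT))))).
have vE i : (i < 4)%N -> v i = p (w i) by case: i => [|[|[|[|i]]]].
apply: (@K5_not_separated R v (r d)).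
- move=> i j; rewrite ltnS (leq_eqVlt j) andb_orr.
  case/orP => [/andP[ij /eqP jE]|ij]; first rewrite {}jE in ij *.
    rewrite (vE i) //; apply/eqP => wE; apply: Dfar.
    by left; exists (w i).
  have [i4 j4] : (i < 4)%N /\ (j < 4)%N by clear - ij; lia.
  by rewrite !vE // (inj_eq (embedding_inj emb)) w_neq.
- move=> i j; rewrite ltnS (leq_eqVlt j) andb_orr.
  case/orP => [/andP[ij /eqP jE]|ij]; first rewrite {}jE in ij *.
    by rewrite /r eqxx vE.
  have [i4 j4] : (i < 4)%N /\ (j < 4)%N by clear - ij; lia.
  rewrite /r ifN ?ltn_eqF // !vE //.
  exact/(chained_arcs emb)/S_conn.
move=> i j k l /andP[ij j5] /andP[kl l5] ik jk jl; rewrite /r.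
(* Since [w i'] is not in [S k' l'], the arcs of the latter belong to the drawing avoided by the
   chain from [w i'] to the apex. *)
have avoid i' k' l' : (i' < 4)%N -> (k' < l' < 4)%N -> i' != k' -> i' != l' ->
    separated (away (arcs e gamma (~: [set w i']%SET)) d)
      (near_in (arcs e gamma (S k' l')) d).
  move=> i4 kl' ik' il'; apply: near_in_away_separated; apply: arcs_sub.
  apply/fintype.subsetP => x; rewrite !inE; apply: contraTneq => ->.
  exact: S_vertex.
have [j4|j4] := eqVneq j 4.
  rewrite j4 eq_sym in jl; rewrite (negPf jl).
  by apply: avoid; clear - ij kl l5 ik jk jl j4; lia.
have [l4|l4] := eqVneq l 4.
  by apply/separated_sym/avoid; clear - ij kl j5 ik jk jl l4 j4; lia.
have [[-> [-> [-> ->]]]|[[-> [-> [-> ->]]]|[-> [-> [-> ->]]]]] //: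
  (i = 0 /\ j = 1 /\ k = 2 /\ l = 3 \/ i = 0 /\ j = 2 /\ k = 1 /\ l = 3 \/
   i = 0 /\ j = 3 /\ k = 1 /\ l = 2)%N
  by clear - ij kl j5 l5 ik jk jl l4 j4; lia.
Qed.

End K4.

Theorem theorem5p6 (R : realType) (T : finType) (e : rel T)
  (e_sym : symmetric e) (e_irr : irreflexive e)
  (e_conn : forall x y : T, connect e x y)
  (e_outer : outerplanar R e) :
  (surrounding_cop_number e <= 3)%N.
Proof.
exact: (surrounding_cop_number_le3 e_sym e_conn (outerplanar_K4_free e_sym e_outer)).
Qed.
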